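(* Let $n\ge 1$. Every $n$-periodic infinite frieze $\mathcal{F}_\Pi$ associated to a triangulation $\Pi$ of the once-punctured disc $S_n^1$ is $n$-arithmetic.
   Context: Infinite friezes: an infinite frieze is an array $(m_{ij})_{i,j\in\mathbb{Z},\,j-i\ge -2}$ of integers with $m_{i,i-2}=0$ and $m_{i,i-1}=1$ for all $i\in\mathbb{Z}$, $m_{ij}>0$ for all $j\ge i$, and $m_{ij}m_{i+1,j+1}-m_{i+1,j}m_{i,j+1}=1$ for all $j-i\ge -1$. It is $n$-periodic if $m_{ij}=m_{i+n,j+n}$ for all $i\le j$. Its quiddity sequence is then the $n$-tuple $(m_{11},\dots,m_{nn})$ (up to cyclic equivalence); it determines the frieze. Arithmetic friezes: for an infinite frieze $\mathcal{F}=(m_{ij})_{j-i\ge-2}$ and an integer $r\ge 1$, put $d_{ik}:=m_{i,(i+k-3)+r}-m_{i,i+k-3}$ for all $i\in\mathbb{Z}$ and $k\in\{1,\dots,r\}$. $\mathcal{F}$ is $r$-arithmetic if $m_{i,(i+k-3)+(l+1)r}-m_{i,(i+k-3)+lr}=d_{ik}$ for all $l\ge 0$, all $i\in\mathbb{Z}$ and all $k\in\{1,\dots,r\}$. Triangulations: for $n\ge 1$, $S_n^1$ is a closed disc with $n$ marked points on the boundary, labeled $1,2,\dots,n$ in clockwise order, and one marked point in the interior, the puncture, labeled $0$. An arc in $S_n^1$ is (the isotopy class of) a non-self-intersecting curve connecting two marked points (possibly equal, in which case it is a loop) which is non-boundary, i.e. not isotopic to a boundary segment between neighboring marked points. The arcs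 are: the bridging arcs $0j$ connecting the puncture with the boundary marked point $j$; and the peripheral arcs $ij$ ($i=j$ allowed), where $ij$ is the arc isotopic to the boundary segment going clockwise from $i$ to $j$ when all marked points on the boundary other than $i$ and $j$ are ignored. Two arcs are non-crossing if they do not meet in the interior of $S_n^1$ (away from the puncture). A triangulation $\Pi$ of $S_n^1$ is a maximal collection of pairwise non-crossing arcs. The quiddity sequence of $\Pi$ is $q_\Pi=(a_1,\dots,a_n)$, where $a_i$ is the number of connected components of $(S_n^1\setminus\Pi)\cap U$ for $U$ a small neighborhood of the boundary marked point $i$. The infinite frieze $\mathcal{F}_\Pi$ associated to $\Pi$ is the $n$-periodic infinite frieze whose quiddity sequence is $q_\Pi$ (it exists). *)

(* Defs.v *)
From HB Require Import structures.
From mathcomp Require Import all_boot all_order all_algebra.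

Set Implicit Arguments.
Unset Strict Implicit.
Unset Printing Implicit Defensive.

Import Order.TTheory GRing.Theory Num.Theory.
Local Open Scope ring_scope.

(* An array with j - i >= -2 is a total function on int * int whose values at
   j < i - 2 are never referred to. *)
Definition infinite_frieze (m : int -> int -> int) : Prop :=
  [/\ forall i, m i (i - 2) = 0,
      forall i, m i (i - 1) = 1,
      forall i j, i <= j -> 0 < m i j
    & forall i j, -1 <= j - i ->
        m i j * m (i + 1) (j + 1) - m (i + 1) j * m i (j + 1) = 1].

Definition periodic (n : nat) (m : int -> int -> int) : Prop :=
  forall i j, i <= j -> m i j = m (i + n%:Z) (j + n%:Z).

Definition arith_diff (r : nat) (m : int -> int -> int) (i : int) (k : nat) :=
  m i (i + k%:Z - 3 + r%:Z) - m i (i + k%:Z - 3).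

Definition arithmetic (r : nat) (m : int -> int -> int) : Prop :=
  forall (l : nat) (i : int) (k : nat), (1 <= k <= r)%N ->
    m i (i + k%:Z - 3 + l.+1%:Z * r%:Z) - m i (i + k%:Z - 3 + l%:Z * r%:Z)
    = arith_diff r m i k.

(* Isotopy classes of curves in the once-punctured disc with n marked boundary
   points.  The ordinal i : 'I_n stands for the boundary point labelled i + 1
   (labels 1, ..., n in clockwise order); the puncture is not an ordinal.
   [bridging j] joins the puncture to j; [peripheral i j] follows the boundary
   clockwise from i to j, and is a loop around the puncture when i = j. *)
Definition curve (n : nat) := ('I_n + 'I_n * 'I_n)%type.

Definition bridging n (j : 'I_n) : curve n := inl j.
Definition peripheral n (i j : 'I_n) : curve n := inr (i, j).

(* Number of boundary segments followed by [peripheral i j]: it lies in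
   {1, ..., n} and is n, not 0, when i = j. *)
Definition cwlen n (i j : 'I_n) : nat :=
  if (i < j)%N then (j - i)%N else (j + n - i)%N.

(* [peripheral i j] is isotopic to a boundary segment between neighbours
   exactly when it follows a single segment (for n = 1 this is the loop). *)
Definition is_arc n (c : curve n) : bool :=
  match c with
  | inl _ => true
  | inr (i, j) => cwlen i j != 1%N
  end.

(* Crossing is read off in the universal cover of the disc minus the puncture,
   a half-plane whose boundary line carries the integers as marked points, with
   deck group generated by x |-> x + n and the puncture at infinity.  The lifts
   of [peripheral i j] join i + k n to i + k n + cwlen i j, those of
   [bridging j] go from j + k n to infinity.  Two arcs are forced to meet in the
   interior iff some pair of lifts have strictly interleaved endpoints; by
   translation, one of the two lifts may be taken with k = 0.  Arcs sharing
   an endpoint do not cross there. *)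
Definition interleaved (a b c d : int) : Prop := a < c /\ c < b /\ b < d.

Definition cross_bp n (j i k : 'I_n) : Prop :=
  exists t : int, i%:Z < j%:Z + t * n%:Z
               /\ j%:Z + t * n%:Z < i%:Z + (cwlen i k)%:Z.

Definition cross_pp n (i j k l : 'I_n) : Prop :=
  exists t : int,
    let a := i%:Z in
    let b := i%:Z + (cwlen i j)%:Z in
    let c := k%:Z + t * n%:Z in
    let d := k%:Z + t * n%:Z + (cwlen k l)%:Z in
    interleaved a b c d \/ interleaved c d a b.

Definition crossing n (c1 c2 : curve n) : Prop :=
  match c1, c2 with
  | inl _, inl _ => False
  | inl j, inr (i, k) => cross_bp j i k
  | inr (i, k), inl j => cross_bp j i k
  | inr (i, j), inr (k, l) => cross_pp i j k l
  end.

Definition noncrossing_arcs n (P : {set curve n}) : Prop :=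
  (forall a, a \in P -> is_arc a) /\
  (forall a b, a \in P -> b \in P -> ~ crossing a b).

Definition triangulation n (P : {set curve n}) : Prop :=
  noncrossing_arcs P /\
  (forall Q : {set curve n}, noncrossing_arcs Q -> P \subset Q -> Q = P).

(* Number of ends of a curve at a boundary point; a loop has two. *)
Definition ends_at n (c : curve n) (i : 'I_n) : nat :=
  match c with
  | inl j => (j == i : nat)
  | inr (j, k) => ((j == i) + (k == i))%N
  end.

(* A small neighbourhood of a boundary point is a half-disc, which e arc ends
   issuing from that point cut into e + 1 components. *)
Definition quiddity_of n (P : {set curve n}) (i : 'I_n) : nat :=
  (\sum_(c in P) ends_at c i)%N.+1.

(* (m_11, ..., m_nn) is the quiddity sequence of P. *)
Definition has_quiddity n (m : int -> int -> int) (P : {set curve n}) : Prop :=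
  forall i : 'I_n, m (i.+1)%:Z (i.+1)%:Z = (quiddity_of P i)%:Z.

(* The frieze of P is unique up to the irrelevant values at j < i - 2. *)
Definition frieze_of n (P : {set curve n}) (m : int -> int -> int) : Prop :=
  [/\ infinite_frieze m, periodic n m & has_quiddity m P].

(* Main.v *)
(* Row i of the frieze solves x_{j-1} + x_{j+1} = q_j x_j with n-periodic
   coefficients given by the quiddity sequence. The triangulation provides a positive
   n-periodic solution v of the same recurrence: lift it to the line, put v = 1 at
   the ends of bridging arcs and v_c = v_a + v_b whenever a triangle a < c < b lies
   under the edge ab; summing over the triangles around a vertex gives the
   recurrence. The monodromy thus has determinant 1 and eigenvalue 1, hence trace 2,
   which is arithmeticity. *)
Require Import Defs.
From mathcomp Require Import all_boot all_order all_algebra.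
From mathcomp Require Import zify ring lra.

Set Implicit Arguments.
Unset Strict Implicit.
Unset Printing Implicit Defensive.

Import Order.TTheory GRing.Theory Num.Theory.
Local Open Scope ring_scope.

(** * Lifted triangulations and their mirror symmetry *)

(* A triangulation seen in the universal cover: [E a b] says that a < b are joined
   by a lifted peripheral arc or boundary segment, [B a] that a is an endpoint
   of a lifted bridging arc. *)
Record lifted_triangulation (n : nat) (E : rel int) (B : pred int) : Prop := {
  edge_len : forall a b, E a b -> a < b <= a + n%:Z;
  edge_step : forall a, E a (a + 1);
  edge_noncross : forall a b c d, E a b -> E c d -> ~ interleaved a b c d;
  edge_bridge : forall a b c, E a b -> B c -> ~ (a < c < b);
  edge_shift : forall a b, E (a + n%:Z) (b + n%:Z) = E a b;
  bridge_shift : forall a, B (a + n%:Z) = B a;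
  edge_max : forall a b, a < b <= a + n%:Z ->
    (forall c, B c -> ~ (a < c < b)) ->
    (forall c d, E c d -> ~ interleaved a b c d /\ ~ interleaved c d a b) ->
    E a b;
  bridge_max : forall a, (forall c d, E c d -> ~ (c < a < d)) -> B a }.

(** The reflection of the line about 0 exchanges left and right, so facts about left neighbours
    follow from those about right neighbours. *)
Definition mirror_edge (E : rel int) : rel int := fun a b => E (- b) (- a).
Definition mirror_bridge (B : pred int) : pred int := fun a => B (- a).

Lemma mirror_triangulation n E B : lifted_triangulation n E B ->
  lifted_triangulation n (mirror_edge E) (mirror_bridge B).
Proof.
rewrite /mirror_edge /mirror_bridge => -[len step ncr br sh bsh mx bmx]; split.
- by move=> a b /len; lia.
- by move=> a; move: (step (- (a + 1))); congr (E _ _); lia.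
- move=> a b c d Eab Ecd; move: (ncr _ _ _ _ Ecd Eab); rewrite /interleaved; lia.
- by move=> a b c Eab Bc; move: (br _ _ _ Eab Bc); lia.
- by move=> a b; rewrite -[LHS]sh; congr (E _ _); lia.
- by move=> a; rewrite -[LHS]bsh; congr (B _); lia.
- move=> a b ab hB hE; apply: mx; first by lia.
    move=> c Bc; move: (hB (- c)); rewrite opprK => /(_ Bc); lia.
  move=> c d Ecd; move: (hE (- d) (- c)); rewrite !opprK => /(_ Ecd).
  rewrite /interleaved; lia.
- move=> a hE; apply: bmx => c d Ecd.
  by move: (hE (- d) (- c)); rewrite !opprK => /(_ Ecd); lia.
Qed.

(** * Outermost neighbours of a vertex *)

(** In a lifted triangulation every edge has length at most n, so the range of [t] misses none; the
    boundary step makes it nonempty, so the maximum is attained rather than defaulting to 0. *)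
Definition rnbr n (E : rel int) (c : int) : int :=
  c + (\max_(t < n.+1 | E c (c + t%:Z)) t)%:Z.
Definition lnbr n (E : rel int) (c : int) : int := - rnbr n (mirror_edge E) (- c).

Lemma rnbr_edge n E B c : lifted_triangulation n E B -> E c (rnbr n E c).
Proof.
move=> L; rewrite /rnbr.
have [/andP[_ n0] s1] := (edge_len L (edge_step L c), edge_step L c).
have n1 : (1 < n.+1)%N by lia.
case: (@eq_bigmax_cond _ [pred t : 'I_n.+1 | E c (c + t%:Z)] val) => [|t Et ->] //.
by apply/card_gt0P; exists (Ordinal n1).
Qed.

Lemma rnbr_max n E B c y : lifted_triangulation n E B -> E c y -> y <= rnbr n E c.
Proof.
move=> L Ecy; have /andP[cy yn] := edge_len L Ecy.
have tn : (`|y - c|%N < n.+1)%N by lia.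
have yE : y = c + (Ordinal tn : nat)%:Z by rewrite /=; lia.
have := @leq_bigmax_cond _ [pred t : 'I_n.+1 | E c (c + t%:Z)] val (Ordinal tn).
rewrite /= -[X in E c X]yE => /(_ Ecy) le.
by rewrite /rnbr {1}yE /=; lia.
Qed.

Lemma lnbr_edge n E B c : lifted_triangulation n E B -> E (lnbr n E c) c.
Proof. by move=> /mirror_triangulation/(rnbr_edge (- c));
  rewrite /mirror_edge opprK. Qed.

Lemma lnbr_min n E B c x : lifted_triangulation n E B -> E x c -> lnbr n E c <= x.
Proof.
move=> /mirror_triangulation L Exc; rewrite /lnbr.
have := @rnbr_max _ _ _ (- c) (- x) L; rewrite /mirror_edge !opprK => /(_ Exc); lia.
Qed.

Lemma rnbr_eq n E B c y : lifted_triangulation n E B ->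
  E c y -> (forall z, E c z -> z <= y) -> rnbr n E c = y.
Proof.
move=> L Ecy ymax; move: (rnbr_max L Ecy) (ymax _ (rnbr_edge c L)); lia.
Qed.

Lemma lnbr_eq n E B c x : lifted_triangulation n E B ->
  E x c -> (forall z, E z c -> x <= z) -> lnbr n E c = x.
Proof.
move=> L Exc xmin; move: (lnbr_min L Exc) (xmin _ (lnbr_edge c L)); lia.
Qed.

Lemma rnbr_shift n E B c : lifted_triangulation n E B ->
  rnbr n E (c + n%:Z) = rnbr n E c + n%:Z.
Proof.
move=> L; apply: (rnbr_eq L); first by rewrite (edge_shift L) (rnbr_edge c L).
move=> z; have -> : z = (z - n%:Z) + n%:Z by lia.
by rewrite (edge_shift L) => /(rnbr_max L); lia.
Qed.

Lemma lnbr_shift n E B c : lifted_triangulation n E B ->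
  lnbr n E (c + n%:Z) = lnbr n E c + n%:Z.
Proof.
move=> L; apply: (lnbr_eq L); first by rewrite (edge_shift L) (lnbr_edge c L).
move=> z; have -> : z = (z - n%:Z) + n%:Z by lia.
by rewrite (edge_shift L) => /(lnbr_min L); lia.
Qed.

Lemma lnbr_mirror n E c : lnbr n (mirror_edge E) c = - rnbr n E (- c).
Proof.
rewrite /lnbr /rnbr /mirror_edge; congr (- (_ + Posz _)).
by apply: eq_bigl => t; congr (E _ _); lia.
Qed.

Lemma rnbr_mirror n E c : rnbr n (mirror_edge E) c = - lnbr n E (- c).
Proof. by rewrite /lnbr !opprK. Qed.

(** Off the bridges, [bridge_max] yields an edge xy with x < c < y; it spans both outermost
    neighbours of c, which bounds their distance by n and keeps bridges out. An edge crossing the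
    new one without crossing its two sides would have to start or end at c and reach beyond an
    outermost neighbour. *)
Lemma outer_edge n E B c : lifted_triangulation n E B -> ~~ B c ->
  E (lnbr n E c) (rnbr n E c).
Proof.
move=> L nBc.
have [El Er] := (lnbr_edge c L, rnbr_edge c L).
have /andP[lc _] := edge_len L El; have /andP[cr _] := edge_len L Er.
(* With x = c - [s.+1] and y = x + [t.+1], the condition s < t says c < y; the search for a spanning
   edge is thus finite and decidable. *)
have [/existsP[s /existsP[t Est]]|none] :=
    boolP [exists s : 'I_n, exists t : 'I_n,
             E (c - s.+1%:Z) (c - s.+1%:Z + t.+1%:Z) && (s < t)%N]; last first.
  case/negP: nBc; apply: (bridge_max L) => x y Exy /andP[xc cy].
  have /andP[_ yn] := edge_len L Exy.
  have sn : (`|c - x|.-1 < n)%N by lia.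
  have tn : (`|y - x|.-1 < n)%N by lia.
  case/negP: none; apply/existsP; exists (Ordinal sn); apply/existsP.
  exists (Ordinal tn); apply/andP; split; last by rewrite /=; lia.
  by move: Exy; congr (E _ _); rewrite /=; lia.
move: Est; set x := c - _; set y := x + _ => /andP[Exy st].
have xc : x < c by rewrite /x; lia.
have cy : c < y by rewrite /y /x; lia.
have /andP[_ yn] := edge_len L Exy.
have xl : x <= lnbr n E c.
  by move: (edge_noncross L El Exy); rewrite /interleaved; lia.
have ry : rnbr n E c <= y.
  by move: (edge_noncross L Exy Er); rewrite /interleaved; lia.
apply: (edge_max L); first by lia.
  by move=> d Bd; move: (edge_bridge L Exy Bd); lia.
move=> u w Euw.
have uc : w = c -> lnbr n E c <= u by move=> wc; apply: (lnbr_min L); rewrite -wc.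
have wc : u = c -> w <= rnbr n E c by move=> e; apply: (rnbr_max L); rewrite -e.
move: (edge_noncross L El Euw) (edge_noncross L Euw El) (edge_noncross L Er Euw)
  (edge_noncross L Euw Er) (edge_len L Euw).
rewrite /interleaved; lia.
Qed.

(** Consecutive edges of the fan at j close up to a triangle: an edge crossing r r' would cross j r
    or j r', or would issue from j between them. Hence r is the middle vertex under the edge j
    r'. *)
Lemma fan_triangle n E B j r r' : lifted_triangulation n E B ->
  E j r -> E j r' -> r < r' -> (forall z, E j z -> z <= r \/ r' <= z) ->
  [/\ ~~ B r, lnbr n E r = j & rnbr n E r = r'].
Proof.
move=> L Er Er' rr' gap.
have [jr jr'] := (edge_len L Er, edge_len L Er').
have Err' : E r r'.
  apply: (edge_max L); first by lia.
    by move=> c Bc; move: (edge_bridge L Er' Bc); lia.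
  move=> c d Ecd.
  have hc : c = j -> d <= r \/ r' <= d by move=> e; apply: gap; rewrite -e.
  move: (edge_noncross L Er Ecd) (edge_noncross L Ecd Er) (edge_noncross L Er' Ecd)
    (edge_noncross L Ecd Er') (edge_len L Ecd).
  rewrite /interleaved; lia.
split.
- by apply/negP => /(edge_bridge L Er'); lia.
- apply: (lnbr_eq L Er) => z Ezr; move: (edge_noncross L Ezr Er').
  by rewrite /interleaved; lia.
- apply: (rnbr_eq L Err') => z Erz; move: (edge_noncross L Er' Erz).
  by rewrite /interleaved; lia.
Qed.

(** The outermost right neighbour is the next bridge endpoint: no edge passes over a bridge
    endpoint, so maximality joins the two, and no edge from j reaches farther. *)
Lemma bridge_rnbr n E B j : lifted_triangulation n E B -> B j -> B (rnbr n E j).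
Proof.
move=> L Bj.
have /andP[j1 j2] := edge_len L (edge_step L j).
(* By periodicity j + n is a bridge endpoint, so the next one is at distance at most n; it is j + n
   itself when there is a single bridging arc. *)
have ex : exists t, B (j + t.+1%:Z).
  by exists n.-1; move: Bj; rewrite -(bridge_shift L); congr (B _); lia.
have [t Bt tmin] := ex_minnP ex.
have tn : (t <= n.-1)%N.
  by apply: tmin; move: Bj; rewrite -(bridge_shift L); congr (B _); lia.
have next c : B c -> ~ (j < c < j + t.+1%:Z).
  move=> Bc jc; suff /tmin : B (j + (`|c - j|.-1).+1%:Z) by lia.
  by move: Bc; congr (B _); lia.
suff -> : rnbr n E j = j + t.+1%:Z by [].
apply: (rnbr_eq L).
  apply: (edge_max L) => //; first by lia.
  move=> c d Ecd; move: (edge_bridge L Ecd Bj) (edge_bridge L Ecd Bt).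
  by rewrite /interleaved; lia.
by move=> z Ejz; move: (edge_bridge L Ejz Bt) (edge_len L Ejz); lia.
Qed.

Lemma bridge_lnbr n E B j : lifted_triangulation n E B -> B j -> B (lnbr n E j).
Proof.
move=> /mirror_triangulation L Bj.
by apply: (bridge_rnbr (j := - j) L); rewrite /mirror_bridge opprK.
Qed.

(** * The positive periodic solution *)

(* [k] is fuel: off the bridges, passing to an outer neighbour strictly enlarges
   the outer edge, whose length is at most n, so k = n suffices. *)
Fixpoint weight n (E : rel int) (B : pred int) (k : nat) (c : int) : int :=
  if k is k'.+1 then
    if B c then 1
    else weight n E B k' (lnbr n E c) + weight n E B k' (rnbr n E c)
  else 1.

Lemma weight_gt0 n E B k c : 0 < weight n E B k c.
Proof. by elim: k c => [|k IH] c //=; case: ifP => // _; rewrite addr_gt0. Qed.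

Lemma weight_shift n E B k c : lifted_triangulation n E B ->
  weight n E B k (c + n%:Z) = weight n E B k c.
Proof.
move=> L; elim: k c => [|k IH] c //=.
by rewrite (bridge_shift L) (lnbr_shift c L) (rnbr_shift c L) !IH.
Qed.

Lemma weight_stable n E B k c : lifted_triangulation n E B ->
  B c \/ n%:Z < k%:Z + (rnbr n E c - lnbr n E c) ->
  weight n E B k.+1 c = weight n E B k c.
Proof.
move=> L; elim: k c => [|k IH] c /=; case: ifPn => // nBc [|gap] //;
  have Eo := outer_edge L nBc.
  by move: (edge_len L Eo); lia.
have [El Er] := (edge_len L (lnbr_edge c L), edge_len L (rnbr_edge c L)).
(* The outer edge of c is an edge at each of its ends. Hence the outer edge of a non-bridge end
   contains it and is longer by at least one, which pays for the unit of fuel spent. *)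
congr (_ + _); apply: IH; case: (boolP (B _)) => [|nB]; [by left| |by left|];
  right.
  move: (rnbr_max L Eo) (edge_len L (lnbr_edge (lnbr n E c) L)); lia.
move: (lnbr_min L Eo) (edge_len L (rnbr_edge (rnbr n E c) L)); lia.
Qed.

Lemma weightE n E B c : lifted_triangulation n E B ->
  weight n E B n c =
  if B c then 1
  else weight n E B n (lnbr n E c) + weight n E B n (rnbr n E c).
Proof.
move=> L; rewrite -(@weight_stable n E B n c L) //.
by right; move: (edge_len L (lnbr_edge c L)) (edge_len L (rnbr_edge c L)); lia.
Qed.

(** * Summing over the triangles around a vertex *)

Definition rdeg n (E : rel int) (j : int) : nat :=
  (\sum_(s < n) E j (j + s.+1%:Z)%R)%N.

(** Telescoping: consecutive right neighbours r < r' of j satisfy v r = v j + v r'. There is one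
    triangle fewer than edges, whence the additional [v j] on the left. *)
Lemma right_fan n E B (v : int -> int) (j : int) : lifted_triangulation n E B ->
  (forall c, ~~ B c -> v c = v (lnbr n E c) + v (rnbr n E c)) ->
  v (j + 1) + v j = (rdeg n E j)%:Z * v j + v (rnbr n E j).
Proof.
move=> L hv.
(* Sweep over lengths: [s.+1] is the largest length, among those up to [t.+1], of an edge leaving j
   to the right. *)
have key t : exists s : nat, [/\ (s <= t)%N, E j (j + s.+1%:Z),
    forall z, E j z -> z <= j + s.+1%:Z \/ j + t.+1%:Z < z &
    v (j + 1) + v j = (rdeg t.+1 E j)%:Z * v j + v (j + s.+1%:Z)].
  elim: t => [|t [s [st Es gap IH]]].
    exists 0%N; rewrite /rdeg big_ord1 (edge_step L); split=> //.
      by move=> z _; lia.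
    by rewrite mul1r addrC.
  rewrite /rdeg big_ord_recr -/(rdeg _ _ _) /=.
  have [Et|nEt] := boolP (E j _); last first.
    exists s; split=> //; [by lia| |by rewrite addn0].
    move=> z Ez; case: (gap z Ez) => [|tz]; [by left|right].
    suff : z != j + t.+2%:Z by lia.
    by apply: contraNneq nEt => <-.
  exists t.+1; split=> //; first by move=> z Ez; lia.
  have gap' z : E j z -> z <= j + s.+1%:Z \/ j + t.+2%:Z <= z.
    by move=> /gap; lia.
  have st' : j + s.+1%:Z < j + t.+2%:Z by lia.
  have [nB ll rr] := fan_triangle L Es Et st' gap'.
  by rewrite IH (hv _ nB) ll rr PoszD mulrDl mul1r addrA.
have := edge_len L (edge_step L j) => jn.
have [s [sn Es gap ->]] := key n.-1.
have -> : n.-1.+1 = n by lia.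
congr (_ + v _); apply/esym/(rnbr_eq L Es) => z Ez.
by move: (gap z Ez) (edge_len L Ez); lia.
Qed.

Definition ldeg n (E : rel int) (j : int) : nat :=
  (\sum_(s < n) E (j - s.+1%:Z)%R j)%N.

Lemma left_fan n E B (v : int -> int) (j : int) : lifted_triangulation n E B ->
  (forall c, ~~ B c -> v c = v (lnbr n E c) + v (rnbr n E c)) ->
  v (j - 1) + v j = (ldeg n E j)%:Z * v j + v (lnbr n E j).
Proof.
move=> /mirror_triangulation L hv.
have := @right_fan _ _ _ (fun c => v (- c)) (- j) L; rewrite rnbr_mirror.
rewrite !opprK opprD opprK => -> => [|c].
  congr (Posz _ * _ + _); apply: eq_bigr => s _.
  by rewrite /mirror_edge opprK opprD opprK.
rewrite /mirror_bridge lnbr_mirror rnbr_mirror !opprK => /hv ->.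
by rewrite addrC.
Qed.

(** Adding the two fans leaves the weights of the outermost neighbours. They sum to v j off the
    bridges by definition of the weight, and to 1 + 1 = 2 v j at a bridge endpoint, whose outermost
    neighbours are bridge endpoints too. *)
Lemma weight_rec n E B (j : int) : lifted_triangulation n E B ->
  let v := weight n E B n in
  v (j - 1) + v (j + 1) + v j = (rdeg n E j + ldeg n E j + B j)%:Z * v j.
Proof.
move=> L v.
have hv c : ~~ B c -> v c = v (lnbr n E c) + v (rnbr n E c).
  by move=> nB; rewrite /v weightE // (negPf nB).
have [hr hl] := (right_fan j L hv, left_fan j L hv).
have hs : v (lnbr n E j) + v (rnbr n E j) = v j + (B j)%:Z * v j.
  case: (boolP (B j)) => Bj; last by rewrite mul0r addr0 -hv.
  by rewrite /v (weightE (lnbr n E j) L) (weightE (rnbr n E j) L) (weightE j L)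
    Bj (bridge_lnbr L Bj) (bridge_rnbr L Bj).
have sum3 (a b c l r p q s : int) :
  a + c = p + r -> b + c = q + l -> l + r = c + s -> b + a + c = p + q + s by lia.
by rewrite !PoszD !mulrDl; apply: sum3 hr hl hs.
Qed.

(** * From a periodic solution to arithmeticity *)

(** Induction on j - i: subtracting two adjacent unimodular relations transfers the recurrence from
    row i + 1 to row i, after cancelling the nonzero entry [m (i + 1) j]. *)
Lemma frieze_rec (m : int -> int -> int) : infinite_frieze m ->
  forall i j : int, i - 1 <= j -> m i (j + 1) + m i (j - 1) = m (j + 1) (j + 1) * m i j.
Proof.
move=> [m0 m1 mpos unim].
have rec (k : nat) i : m i (i - 1 + k%:Z + 1) + m i (i - 1 + k%:Z - 1) =
    m (i - 1 + k%:Z + 1) (i - 1 + k%:Z + 1) * m i (i - 1 + k%:Z).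
  elim: k i => [|k IH] i.
    rewrite addr0 subrK m1 mulr1 -[RHS]addr0 -(m0 i).
    by congr (_ + m _ _); lia.
  have := IH (i + 1).
  have -> : i + 1 - 1 + k%:Z = i - 1 + k.+1%:Z by lia.
  set j := i - 1 + k.+1%:Z => rec_succ.
  have ij : i <= j by rewrite /j; lia.
  have u1 : m i j * m (i + 1) (j + 1) - m (i + 1) j * m i (j + 1) = 1.
    by apply: unim; lia.
  have u2 : m i (j - 1) * m (i + 1) j - m (i + 1) (j - 1) * m i j = 1.
    by have := unim i (j - 1); rewrite subrK; apply; lia.
  have nz : m (i + 1) j != 0.
    have [ij'|ij'] := leP (i + 1) j; first by rewrite gt_eqF ?mpos.
    have jE : j = i + 1 - 1 by lia.
    by rewrite jE m1.
  apply: (mulfI nz); rewrite mulrCA mulrA -rec_succ mulrDr.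
  by rewrite mulrDl; move: u1 u2; lia.
move=> i j ij; have := rec `|(j - i + 1)%R|%N i.
by have -> : i - 1 + `|(j - i + 1)%R|%N%:Z = j by lia.
Qed.

(* The Wronskian of two solutions is constant, so the Wronskian of [v] with
   [x (t + n) - x t] vanishes and that difference is proportional to [v]. *)
Lemma recurrence_arith (n : nat) (b x v : nat -> int) :
  (forall t, b (t + n)%N = b t) -> (forall t, v (t + n)%N = v t) ->
  (forall t, v t != 0) ->
  (forall t, v t.+2 + v t = b t * v t.+1) ->
  (forall t, x t.+2 + x t = b t * x t.+1) ->
  forall t, x (t + n + n)%N - x (t + n)%N = x (t + n)%N - x t.
Proof.
move=> bn vn v0 hv hx.
have wr t : x t * v t.+1 - x t.+1 * v t = x 0%N * v 1%N - x 1%N * v 0%N.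
  elim: t => [|t <-] //.
  have -> : x t.+2 = b t * x t.+1 - x t by rewrite -hx addrK.
  have -> : v t.+2 = b t * v t.+1 - v t by rewrite -hv addrK.
  ring.
pose d t := x (t + n)%N - x t.
have dv t : d t * v t.+1 = d t.+1 * v t.
  have := wr (t + n)%N; rewrite -(wr t) -addSn !vn /d; lra.
have prop t k : d t * v (t + k)%N = d (t + k)%N * v t.
  elim: k => [|k IH]; first by rewrite addn0.
  apply: (mulIf (v0 (t + k)%N)); rewrite addnS.
  by rewrite mulrAC IH mulrAC dv mulrAC.
move=> t; apply: (mulIf (v0 t)).
by have := prop t n; rewrite vn /d => ->.
Qed.

Lemma arithmetic_of_periodic_solution (n : nat) (m : int -> int -> int)
    (v : int -> int) :
  infinite_frieze m -> periodic n m -> (forall j, v j != 0) ->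
  (forall j, v (j + n%:Z) = v j) ->
  (forall j, v (j - 1) + v (j + 1) = m (j + 1) (j + 1) * v j) ->
  arithmetic n m.
Proof.
move=> fm pm v0 vn hv l i k /andP[k1 _].
(* The row is indexed from its boundary entries [x 0] = 0 and [x 1] = 1, so position i + k - 3
   becomes [k.-1], which is faithful since k >= 1. *)
pose x (t : nat) := m i (i - 2 + t%:Z).
pose b (t : nat) := m (i + t%:Z) (i + t%:Z).
have arith : forall t, x (t + n + n)%N - x (t + n)%N = x (t + n)%N - x t.
  apply: (@recurrence_arith n b x (fun t => v (i - 2 + t%:Z))) => [t|t|t|t|t] //.
  - by rewrite /b PoszD addrA -pm.
  - by rewrite PoszD addrA vn.
  - have := hv (i - 2 + t.+1%:Z); rewrite /b addrC.
    have -> : i - 2 + t.+1%:Z + 1 = i + t%:Z by lia.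
    have -> : i - 2 + t.+1%:Z - 1 = i - 2 + t%:Z by lia.
    by have -> : i - 2 + t.+2%:Z = i + t%:Z by lia.
  - have := frieze_rec fm (_ : i - 1 <= i - 2 + t.+1%:Z).
    rewrite /b /x.
    have -> : i - 2 + t.+1%:Z + 1 = i + t%:Z by lia.
    have -> : i - 2 + t.+1%:Z - 1 = i - 2 + t%:Z by lia.
    have -> : i - 2 + t.+2%:Z = i + t%:Z by lia.
    by apply; lia.
have xE s : m i (i + k%:Z - 3 + s%:Z * n%:Z) = x (k.-1 + s * n)%N.
  by rewrite /x; congr (m i _); lia.
have x0 : m i (i + k%:Z - 3) = x k.-1 by rewrite /x; congr (m i _); lia.
have x1 : m i (i + k%:Z - 3 + n%:Z) = x (k.-1 + n)%N.
  by rewrite /x; congr (m i _); lia.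
rewrite /arith_diff x0 x1 !xE; elim: l => [|l IH].
  by rewrite mul1n mul0n addn0.
rewrite -IH.
have -> : (k.-1 + l.+2 * n = k.-1 + l * n + n + n)%N by lia.
by have -> : (k.-1 + l.+1 * n = k.-1 + l * n + n)%N by lia.
Qed.

(** * The covering map and lifts of curves *)

(** The covering map from the integer points of the line to the boundary points. *)
Definition residue (n' : nat) (a : int) : 'I_n'.+1 := inord `|(a %% n'.+1%:Z)%Z|%N.

Lemma residueE n' a : (residue n' a)%:Z = (a %% n'.+1%:Z)%Z.
Proof.
have ge0 := modz_ge0 a (isT : n'.+1%:Z != 0).
have lt := ltz_mod a (isT : n'.+1%:Z != 0).
by rewrite /residue inordK; lia.
Qed.

Lemma residue_lift n' a : exists s : int, a = (residue n' a)%:Z + s * n'.+1%:Z.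
Proof. by exists (a %/ n'.+1%:Z)%Z; rewrite residueE addrC -divz_eq. Qed.

Lemma residue_shift n' a (s : int) : residue n' (a + s * n'.+1%:Z) = residue n' a.
Proof.
apply/val_inj; have := residueE n' (a + s * n'.+1%:Z).
by rewrite addrC modzMDl -residueE => -[].
Qed.

Lemma residue_ord n' (i : 'I_n'.+1) : residue n' i%:Z = i.
Proof.
apply/val_inj; have := residueE n' i%:Z.
by rewrite modz_small => [[]|] //; rewrite lez_nat ltz_nat ltn_ord.
Qed.

Lemma cwlen_bound n (i j : 'I_n) : (1 <= cwlen i j <= n)%N.
Proof. by rewrite /cwlen; move: (ltn_ord i) (ltn_ord j); case: (ltnP i j); lia. Qed.

Lemma residue_cwlen n' (i j : 'I_n'.+1) : residue n' (i%:Z + (cwlen i j)%:Z) = j.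
Proof.
rewrite -[RHS]residue_ord /cwlen; case: (ltnP i j) => h;
  first by congr residue; lia.
rewrite -[RHS](residue_shift n' _ 1); congr residue; have := ltn_ord i; lia.
Qed.

Lemma peripheral_lift n' (i j : 'I_n'.+1) : peripheral i j =
  peripheral (residue n' i%:Z) (residue n' (i%:Z + (cwlen i j)%:Z)).
Proof. by rewrite residue_ord residue_cwlen. Qed.

Lemma cwlen_residue n' a b : a < b <= a + n'.+1%:Z ->
  (cwlen (residue n' a) (residue n' b))%:Z = b - a.
Proof.
move=> ab; have [s hs] := residue_lift n' a; have [t ht] := residue_lift n' b.
have [hi hj] := (ltn_ord (residue n' a), ltn_ord (residue n' b)).
rewrite /cwlen.
move: (residue n' a) (residue n' b) hs ht hi hj => i j hs ht hi hj.
(* The bounds 0 < b - a <= n force b into the same period as a if i < j, and into the next one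
   otherwise; i = j then gives length n. *)
case: (ltnP i j) => h.
  suff st : s = t by lia.
  nia.
suff st : t = s + 1 by lia.
nia.
Qed.

(** Boundary segments are not arcs and so never belong to a triangulation; they are added by hand as
    the steps b = a + 1. *)
Definition lift_edge n' (P : {set curve n'.+1}) : rel int := fun a b =>
  (a < b <= a + n'.+1%:Z) &&
  ((b == a + 1) || (peripheral (residue n' a) (residue n' b) \in P)).

Definition lift_bridge n' (P : {set curve n'.+1}) : pred int := fun a =>
  bridging (residue n' a) \in P.

(** Crossing is defined on standard lifts. Arbitrary lifts differ from these by s and r periods,
    which only changes the translation parameter by s - r. *)
Lemma cross_bp_lift n' a b c : a < b <= a + n'.+1%:Z ->
  cross_bp (residue n' c) (residue n' a) (residue n' b) <->
  exists t, a < c + t * n'.+1%:Z < b.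
Proof.
move=> ab; rewrite /cross_bp (cwlen_residue ab).
have [s hs] := residue_lift n' a; have [r hr] := residue_lift n' c.
split=> -[t ht]; [exists (t + s - r)|exists (t + r - s)];
  move: ht; rewrite ?mulrBl ?mulrDl; lia.
Qed.

Lemma cross_pp_lift n' a b c d :
  a < b <= a + n'.+1%:Z -> c < d <= c + n'.+1%:Z ->
  cross_pp (residue n' a) (residue n' b) (residue n' c) (residue n' d) <->
  exists t, interleaved a b (c + t * n'.+1%:Z) (d + t * n'.+1%:Z) \/
            interleaved (c + t * n'.+1%:Z) (d + t * n'.+1%:Z) a b.
Proof.
move=> ab cd; rewrite /cross_pp (cwlen_residue ab) (cwlen_residue cd).
have [s hs] := residue_lift n' a; have [r hr] := residue_lift n' c.
rewrite /interleaved.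
split=> -[t ht]; [exists (t + s - r)|exists (t + r - s)];
  move: ht; rewrite ?mulrBl ?mulrDl; lia.
Qed.

(** * Lifting a triangulation *)

Lemma crossing_sym n (c1 c2 : curve n) : crossing c1 c2 -> crossing c2 c1.
Proof.
case: c1 c2 => [j|[i k]] [j'|[i' k']] //= -[t ht]; exists (- t).
by move: ht; rewrite /interleaved mulNr; lia.
Qed.

Lemma maximal_mem n (P : {set curve n}) c : triangulation P -> is_arc c ->
  (forall d, d \in c |: P -> ~ crossing c d) -> c \in P.
Proof.
move=> [[arcP ncP] maxP] arcc nc; rewrite -(maxP (c |: P)) ?setU11 ?subsetUr //.
split=> [a|a b]; first by rewrite !inE => /predU1P[->|/arcP].
move=> aQ bQ; case/setU1P: (aQ) => [->|aP]; first exact: nc.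
case/setU1P: (bQ) => [->|bP]; last exact: ncP.
by move/crossing_sym; apply: nc.
Qed.

Lemma edge_peripheral n' (P : {set curve n'.+1}) a b :
  noncrossing_arcs P -> a < b <= a + n'.+1%:Z ->
  peripheral (residue n' a) (residue n' b) \in P -> a + 1 < b.
Proof. by move=> [arcP _] ab /arcP /=; have := cwlen_residue ab; lia. Qed.

Lemma peripheral_edge n' (P : {set curve n'.+1}) (i j : 'I_n'.+1) :
  peripheral i j \in P -> lift_edge P i%:Z (i%:Z + (cwlen i j)%:Z).
Proof.
move=> ijP; rewrite /lift_edge residue_ord residue_cwlen ijP orbT andbT.
by have := cwlen_bound i j; lia.
Qed.

Lemma lift_edge_shift n' (P : {set curve n'.+1}) a b (s : int) :
  lift_edge P (a + s * n'.+1%:Z) (b + s * n'.+1%:Z) = lift_edge P a b.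
Proof. by rewrite /lift_edge !residue_shift; congr (_ && (_ || _)); lia. Qed.

(** Non-crossing fields use the trivial translation; the two maximality fields come from
    [maximal_mem], each crossing being moved to a lift that the hypotheses exclude. *)
Lemma lift_triangulation n' (P : {set curve n'.+1}) : triangulation P ->
  lifted_triangulation n'.+1 (lift_edge P) (lift_bridge P).
Proof.
move=> tP; have [ncP _] := tP; split.
- by move=> a b /andP[].
- by move=> a; rewrite /lift_edge eqxx andbT; lia.
- move=> a b c d /andP[ab /orP[/eqP->|abP]]; first by rewrite /interleaved; lia.
  move=> /andP[cd /orP[/eqP->|cdP]]; first by rewrite /interleaved; lia.
  move=> il; case: ncP => _ /(_ _ _ abP cdP); apply.
  by apply/(cross_pp_lift ab cd); exists 0; rewrite mul0r !addr0; left.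
- move=> a b c /andP[ab /orP[/eqP->|abP]]; first by lia.
  move=> cP acb; case: ncP => _ /(_ _ _ cP abP); apply.
  by apply/(cross_bp_lift c ab); exists 0; rewrite mul0r addr0.
- by move=> a b; rewrite -(lift_edge_shift P a b 1) mul1r.
- by move=> a; rewrite /lift_bridge -[in RHS](residue_shift n' a 1) mul1r.
- move=> a b ab hB hE; rewrite /lift_edge ab /=.
  have [//|ab1 /=] := eqVneq b (a + 1).
  apply: (maximal_mem tP); first by rewrite /=; have := cwlen_residue ab; lia.
  move=> d /setU1P[->|].
    (* No self-crossing: since b - a <= n, a nontrivial translate of the edge shares no interior
       point of the interval from a to b. *)
    move/(cross_pp_lift ab ab) => [t].
    have : t <= -1 \/ t = 0 \/ 1 <= t by lia.
    by rewrite /interleaved => -[|[->|]]; nia.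
  case: d => [j|[k l]] dP.
    rewrite -[inl j]/(bridging j) -(residue_ord j) => /(cross_bp_lift _ ab) [t tj].
    by apply: hB tj; rewrite /lift_bridge residue_shift residue_ord.
  have kl : k%:Z < k%:Z + (cwlen k l)%:Z <= k%:Z + n'.+1%:Z.
    by have := cwlen_bound k l; lia.
  rewrite -[inr _]/(peripheral k l) (peripheral_lift k l).
  move=> /(cross_pp_lift ab kl) [t il].
  have := peripheral_edge dP; rewrite -(lift_edge_shift _ _ _ t) => /hE [].
  by case: il.
- move=> a hE; apply: (maximal_mem tP) => //.
  move=> d /setU1P[->//|]; case: d => [j|[k l]] dP //.
  have kl : k%:Z < k%:Z + (cwlen k l)%:Z <= k%:Z + n'.+1%:Z.
    by have := cwlen_bound k l; lia.
  rewrite -[inr _]/(peripheral k l) (peripheral_lift k l) => /(cross_bp_lift _ kl) [t h].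
  (* The crossing translates the bridge by t periods; translating the edge by -t instead keeps a
     fixed. *)
  have := peripheral_edge dP; rewrite -(lift_edge_shift _ _ _ (- t)) => /hE.
  by move: h; rewrite mulNr; lia.
Qed.

(** * Arc ends counted upstairs and downstairs *)

Lemma residue_inj_near n' a b :
  `|a - b| < n'.+1%:Z -> residue n' a = residue n' b -> a = b.
Proof.
move=> near /(congr1 (fun i : 'I_n'.+1 => i%:Z)); rewrite !residueE => /eqP.
rewrite eqz_mod_dvd => /dvdzP[q hq].
have : q <= -1 \/ q = 0 \/ 1 <= q by lia.
by move: hq => /= hq -[|[q0|]]; [nia|rewrite q0 in hq; lia|nia].
Qed.

Lemma residue_addl_inj n' a : injective (fun s : 'I_n'.+1 => residue n' (a + s.+1%:Z)).
Proof.
move=> s t /residue_inj_near h; apply/val_inj => /=.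
by move: h (ltn_ord s) (ltn_ord t); lia.
Qed.

Lemma residue_subl_inj n' a : injective (fun s : 'I_n'.+1 => residue n' (a - s.+1%:Z)).
Proof.
move=> s t /residue_inj_near h; apply/val_inj => /=.
by move: h (ltn_ord s) (ltn_ord t); lia.
Qed.

(** The two alternatives in [lift_edge] exclude each other, as arcs have length at least 2, so the
    disjunction is a sum. *)
Lemma lift_edge_count n' (P : {set curve n'.+1}) a (t : nat) :
  noncrossing_arcs P -> (t < n'.+1)%N ->
  lift_edge P a (a + t.+1%:Z) =
    ((t == 0%N) + (peripheral (residue n' a) (residue n' (a + t.+1%:Z)) \in P))%N :> nat.
Proof.
move=> ncP tn; have len : a < a + t.+1%:Z <= a + n'.+1%:Z by lia.
rewrite /lift_edge len /=; have := edge_peripheral ncP len.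
case: (_ \in P) => [/(_ isT)|_]; last by rewrite orbF addn0; congr (nat_of_bool _); lia.
by rewrite orbT => h; have -> : (t == 0%N) = false by lia.
Qed.

(** The points a + 1, ..., a + n meet each residue exactly once; the successor accounts for the
    boundary segment. *)
Lemma rdeg_lift n' (P : {set curve n'.+1}) a : noncrossing_arcs P ->
  rdeg n'.+1 (lift_edge P) a =
  (\sum_(k : 'I_n'.+1) (peripheral (residue n' a) k \in P)).+1%N.
Proof.
move=> ncP; rewrite /rdeg.
rewrite (eq_bigr (fun s : 'I_n'.+1 => (s == 0%N :> nat) +
   (peripheral (residue n' a) (residue n' (a + s.+1%:Z)) \in P))%N); last first.
  by move=> s _; rewrite -lift_edge_count.
rewrite big_split /= big_ord_recl /= big1 // addn0 add1n; congr _.+1.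
by rewrite [RHS](reindex_inj (@residue_addl_inj n' a)).
Qed.

Lemma ldeg_lift n' (P : {set curve n'.+1}) a : noncrossing_arcs P ->
  ldeg n'.+1 (lift_edge P) a =
  (\sum_(k : 'I_n'.+1) (peripheral k (residue n' a) \in P)).+1%N.
Proof.
move=> ncP; rewrite /ldeg.
rewrite (eq_bigr (fun s : 'I_n'.+1 => (s == 0%N :> nat) +
   (peripheral (residue n' (a - s.+1%:Z)) (residue n' a) \in P))%N); last first.
  move=> s _; have := lift_edge_count (a - s.+1%:Z) ncP (ltn_ord s).
  by rewrite subrK.
rewrite big_split /= big_ord_recl /= big1 // addn0 add1n; congr _.+1.
by rewrite [RHS](reindex_inj (@residue_subl_inj n' a)).
Qed.

Lemma sum_indicator (T : finType) (Q : pred T) (i : T) :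
  (\sum_(k | Q k) (k == i) = Q i)%N.
Proof.
rewrite big_mkcond (bigD1 i) //= eqxx big1 => [|k /negPf->]; last by case: ifP.
by case: (Q i).
Qed.

(** Right and left degrees include the two boundary segments at a, while the quiddity is one more
    than the number of arc ends; this explains the successor. A loop is counted once on each side,
    matching its two ends. *)
Lemma quiddity_lift n' (P : {set curve n'.+1}) a : noncrossing_arcs P ->
  (quiddity_of P (residue n' a)).+1 =
  (rdeg n'.+1 (lift_edge P) a + ldeg n'.+1 (lift_edge P) a + lift_bridge P a)%N.
Proof.
move=> ncP; rewrite rdeg_lift // ldeg_lift // /quiddity_of /lift_bridge.
move: (residue n' a) => i.
rewrite big_sumType /= sum_indicator.
suff -> : (\sum_(c | inr c \in P) (let (j, k) := c in (j == i) + (k == i)) =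
  \sum_k (peripheral i k \in P) +
    \sum_k (peripheral k i \in P))%N.
  by rewrite addSn addnS !addSn; congr _.+2; exact: addnC.
rewrite (eq_bigr (fun c => (c.1 == i) + (c.2 == i))%N); last by case.
rewrite big_split /=; congr (_ + _)%N.
  rewrite (eq_bigl (fun c => true && (inr (c.1, c.2) \in P))); last by case.
  rewrite -(pair_big_dep xpredT (fun j k => inr (j, k) \in P)
    (fun j _ => j == i : nat)) (exchange_big_dep xpredT) //=.
  by apply: eq_bigr => k _; rewrite sum_indicator.
rewrite (eq_bigl (fun c => true && (inr (c.1, c.2) \in P))); last by case.
rewrite -(pair_big_dep xpredT (fun j k => inr (j, k) \in P)
  (fun _ k => k == i : nat)) /=.
by apply: eq_bigr => k _; rewrite sum_indicator.
Qed.

(** * Periodicity of the frieze and conclusion *)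

Lemma periodic_mul (n : nat) (m : int -> int -> int) (i j s : int) :
  periodic n m -> i <= j -> m (i + s * n%:Z) (j + s * n%:Z) = m i j.
Proof.
move=> pm ij.
have nonneg (k : nat) a b : a <= b -> m (a + k%:Z * n%:Z) (b + k%:Z * n%:Z) = m a b.
  elim: k => [|k IH] ab; first by rewrite mul0r !addr0.
  by rewrite intS mulrDl mul1r !(addrCA _ n%:Z) !(addrC n%:Z) -pm ?IH // lerD2r.
have [s0|s0] := leP 0 s.
  have -> : s = `|s|%N%:Z by lia.
  exact: nonneg.
rewrite -(nonneg `|s|%N) ?lerD2r //.
have -> : `|s|%N%:Z = - s by lia.
by rewrite mulNr !addrK.
Qed.

Theorem proposition3p11 (n : nat) (hn : (1 <= n)%N) (P : {set curve n})
  (hP : triangulation P) (m : int -> int -> int) (hm : frieze_of P m) :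
  arithmetic n m.
Proof.
case: n hn P hP hm => // n' _ P tP [fm pm qm].
have L := lift_triangulation tP.
pose v := weight n'.+1 (lift_edge P) (lift_bridge P) n'.+1.
apply: (arithmetic_of_periodic_solution (v := v)) => // [j|j|j].
- by rewrite gt_eqF ?weight_gt0.
- exact: weight_shift.
(* The ordinal i carries the label i + 1, so the vertex j of the line corresponds to the diagonal
   entry at j + 1. *)
have -> : m (j + 1) (j + 1) = (quiddity_of P (residue n' j))%:Z.
  rewrite -qm; have [s {1 2}->] := residue_lift n' j.
  rewrite -(periodic_mul s pm (lexx (residue n' j).+1%:Z)).
  by congr (m _ _); rewrite -(addn1 (residue n' j)) PoszD addrAC.
(* The additional [v j] on the left cancels against the successor of the quiddity on the right. *)
have : v (j - 1) + v (j + 1) + v j = _ := weight_rec j L.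
rewrite -(quiddity_lift j (proj1 tP)).
by rewrite intS mulrDl mul1r addrC => /addrI.
Qed.
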